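(* Let $B={}_{T_l}^{S}[T_a,T_b,T_c]_{T_r}^{S}$ and $B'={}_{T'_l}^{S'}[T'_a,T'_b,T'_c]_{T'_r}^{S'}$ with $S'=\pm S$ be trivial braids representing two adjacent (actively-interacting) braids, $B$ on the left of $B'$, satisfying the interaction condition: $T_r+T'_l$ is even if $S'=S$, and odd if $S'=-S$. Let $B^f={}_{T^f_l}^{S^f}[T^f_a,T^f_b,T^f_c]_{T^f_r}^{S^f}$ be any trivial braid representing the result $B+B'$ of their interaction. Then $$T_l+T_r+T'_l+T'_r=T^f_l+T^f_r,\qquad \sum_{i\in\{a,b,c\}}(T_i+T'_i)=\sum_{i\in\{a,b,c\}}T^f_i,$$ and $(S^f)^2=S^2=(S')^2$, where the square of a state denotes the product of the left and right end-node signs of the corresponding braid.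
   Context: States are signs $S\in\{+,-\}$ (identified with $\pm1$); $\bar S=-S$ is the opposite sign, and $(-)^nS$ equals $S$ if $n$ is even and $\bar S$ if $n$ is odd. A trivial braid (with both end-nodes in the same state, as is the case for every trivial diagram of an actively-interacting braid) is a symbol $${}_{T_l}^{S}[T_a,T_b,T_c]_{T_r}^{S},$$ i.e. the data of a common end-node state $S\in\{+,-\}$, a left external twist $T_l\in\mathbb{Z}$, a right external twist $T_r\in\mathbb{Z}$, and an ordered triple of internal twists $[T_a,T_b,T_c]\in\mathbb{Z}^3$. Triples are added componentwise. A permutation $\sigma\in S_3$ acts on a triple by moving the entry in position $i$ to position $\sigma(i)$; products act from right to left. The permutations $P^S_n$ are defined by $P^S_0=\mathds{1}$, $P^+_{+1}=(1\ 2)$, $P^+_{-1}=(2\ 3)$, $P^-_{+1}=(2\ 3)$, $P^-_{-1}=(1\ 2)$, and, for $k\ge1$ and each choice of sign, $P^S_{\pm k}=P^{(-)^{k-1}S}_{\pm1}P^S_{\pm(k-1)}$. The simultaneous rotation $R_{n,-n}$, $n\in\mathbb{Z}$, is the map on trivial braids $$R_{n,-n}\left({}_{T_l}^{S}[T_a,T_b,T_c]_{T_r}^{S}\right)={}_{T_l+n}^{(-)^nS}[P^S_n(T_a,T_b,T_c)]_{T_r-n}^{(-)^nS}.$$ Two trivial braids are equivalent, written $\cong$, if one is obtained from the other by some simultaneous rotation $R_{n,-n}$, $n\in\mathbb{Z}$. The connected sum $B\# B'$ of $B={}_{T_l}^{S}[T_a,T_b,T_c]_{T_r}^{S}$ and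 $B'={}_{T'_l}^{S'}[T'_a,T'_b,T'_c]_{T'_r}^{S'}$ is defined exactly when $S=S'$ and $T_r+T'_l=0$, and then $$B\# B'={}_{T_l}^{S}[T_a+T'_a,\,T_b+T'_b,\,T_c+T'_c]_{T'_r}^{S}.$$ Interaction: let $B={}_{T_l}^{S}[T_a,T_b,T_c]_{T_r}^{S}$ and $B'={}_{T'_l}^{S'}[T'_a,T'_b,T'_c]_{T'_r}^{S'}$ satisfy the interaction condition, and put $T=T_r+T'_l$ (the total twist on the common external edge). The result $B+B'$ is obtained by simultaneously rotating one of the two braids so that the common edge is twist-free and the adjacent end-nodes are in the same state, and then taking the connected sum. That is, $B+B'$ is represented by $${}_{T_l}^{S}[T_a,T_b,T_c]_{0}^{S}\ \#\ R_{-T,T}\left({}_{T}^{S'}[T'_a,T'_b,T'_c]_{T'_r}^{S'}\right)\quad\text{or by}\quad R_{T,-T}\left({}_{T_l}^{S}[T_a,T_b,T_c]_{T}^{S}\right)\ \#\ {}_{0}^{S'}[T'_a,T'_b,T'_c]_{T'_r}^{S'},$$ and $B+B'$ is considered up to equivalence: a trivial braid represents $B+B'$ if it is equivalent to one of these two. *)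

(* Defs.v *)
From HB Require Import structures.
From mathcomp Require Import all_boot all_order all_algebra all_fingroup.

Set Implicit Arguments.
Unset Strict Implicit.
Unset Printing Implicit Defensive.

Import Order.TTheory GRing.Theory Num.Theory.
Local Open Scope ring_scope.

Inductive sign : Type := Plus | Minus.

Definition bool_of_sign (S : sign) : bool := if S is Minus then true else false.
Definition sign_of_bool (b : bool) : sign := if b then Minus else Plus.

Lemma bool_of_signK : cancel bool_of_sign sign_of_bool.
Proof. by case. Qed.

HB.instance Definition _ := Equality.copy sign (can_type bool_of_signK).

Definition int_of_sign (S : sign) : int := if S is Plus then 1 else -1.

Definition opp_sign (S : sign) : sign := if S is Plus then Minus else Plus.

(* (-)^n S *)
Definition flip_sign (n : int) (S : sign) : sign :=
  if odd `|n|%N then opp_sign S else S.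

(* 1-based positions in a triple. *)
Definition pos1 : 'I_3 := @Ordinal 3 0 isT.
Definition pos2 : 'I_3 := @Ordinal 3 1 isT.
Definition pos3 : 'I_3 := @Ordinal 3 2 isT.

Definition triple : Type := {ffun 'I_3 -> int}.

(* The entry in position i moves to position s i. *)
Definition permute (s : 'S_3) (t : triple) : triple :=
  [ffun j => t ((s^-1)%g j)].

(* P^S_{+1} and P^S_{-1}; the first argument is the sign of the index. *)
Definition rot_perm1 (d S : sign) : 'S_3 :=
  match d, S with
  | Plus, Plus | Minus, Minus => tperm pos1 pos2
  | Minus, Plus | Plus, Minus => tperm pos2 pos3
  end.

(* P^S_{dk}, where P^S_{d(k'+1)} = P^{(-)^k' S}_{d1} P^S_{dk'} with products
   acting from right to left. MathComp permutation products act from left to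
   right, hence the reversed factors. *)
Fixpoint rot_perm_nat (d S : sign) (k : nat) : 'S_3 :=
  if k is k'.+1 then
    (rot_perm_nat d S k' * rot_perm1 d (flip_sign k'%:Z S))%g
  else 1%g.

Definition rot_perm (S : sign) (n : int) : 'S_3 :=
  rot_perm_nat (if 0 <= n then Plus else Minus) S `|n|%N.

Record trivial_braid : Type := TrivialBraid {
  state : sign;
  ltwist : int;
  itwists : triple;
  rtwist : int
}.

Definition left_state (B : trivial_braid) : sign := state B.
Definition right_state (B : trivial_braid) : sign := state B.

(* S^2 for the state S of B *)
Definition state_sq (B : trivial_braid) : int :=
  int_of_sign (left_state B) * int_of_sign (right_state B).

(* R_{n,-n} *)
Definition rotate (n : int) (B : trivial_braid) : trivial_braid :=
  TrivialBraid (flip_sign n (state B)) (ltwist B + n)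
    (permute (rot_perm (state B) n) (itwists B)) (rtwist B - n).

Definition braid_equiv (B1 B2 : trivial_braid) : Prop :=
  (exists n : int, B2 = rotate n B1) \/ (exists n : int, B1 = rotate n B2).

Definition csum (B B' : trivial_braid) : option trivial_braid :=
  if (state B == state B') && (rtwist B + ltwist B' == 0) then
    Some (TrivialBraid (state B) (ltwist B) (itwists B + itwists B') (rtwist B'))
  else None.

Definition common_twist (B B' : trivial_braid) : int := rtwist B + ltwist B'.

Definition set_ltwist (T : int) (B : trivial_braid) : trivial_braid :=
  TrivialBraid (state B) T (itwists B) (rtwist B).
Definition set_rtwist (T : int) (B : trivial_braid) : trivial_braid :=
  TrivialBraid (state B) (ltwist B) (itwists B) T.

Definition interaction_condition (B B' : trivial_braid) : Prop :=
  (state B' = state B -> ~~ odd `|common_twist B B'|%N) /\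
  (state B' = opp_sign (state B) -> odd `|common_twist B B'|%N).

(* The two ways of performing the interaction: rotate the right braid by
   R_{-T,T}, or the left braid by R_{T,-T}, where T is the common twist. *)
Definition interaction_r (B B' : trivial_braid) : option trivial_braid :=
  let T := common_twist B B' in
  csum (set_rtwist 0 B) (rotate (- T) (set_ltwist T B')).
Definition interaction_l (B B' : trivial_braid) : option trivial_braid :=
  let T := common_twist B B' in
  csum (rotate T (set_rtwist T B)) (set_ltwist 0 B').

Definition represents_interaction (B B' Bf : trivial_braid) : Prop :=
  exists2 C : trivial_braid,
    interaction_r B B' = Some C \/ interaction_l B B' = Some C &
    braid_equiv Bf C.

(* Main.v *)
(* The sum of the two external twists and the sum of the internal twists are
   both invariant under simultaneous rotation, and both are additive under the
   connected sum. All signs square to 1. *)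
Require Import Defs.
From mathcomp Require Import all_boot all_order all_algebra all_fingroup.
From mathcomp Require Import ring.

Set Implicit Arguments.
Unset Strict Implicit.
Unset Printing Implicit Defensive.

Import Order.TTheory GRing.Theory Num.Theory.
Local Open Scope ring_scope.

(** Track two integers per braid, [external_twist] and [internal_twist]. A rotation moves n from one
    end to the other and permutes the triple, so it fixes both, and hence they descend to
    equivalence classes. Interaction only redistributes the twist of the common edge, rotates one
    braid and takes a connected sum, and both integers add under that sum. *)

Definition external_twist (B : trivial_braid) : int := ltwist B + rtwist B.

Definition internal_twist (B : trivial_braid) : int := \sum_(i < 3) itwists B i.

Lemma state_sqE (B : trivial_braid) : state_sq B = 1.
Proof. by rewrite /state_sq /left_state /right_state; case: (state B). Qed.

Lemma sum_permute (s : 'S_3) (t : triple) :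
  \sum_(i < 3) permute s t i = \sum_(i < 3) t i.
Proof.
rewrite [RHS](reindex_inj (@perm_inj _ (s^-1)%g)).
by apply: eq_bigr => i _; rewrite ffunE.
Qed.

Lemma external_twist_rotate (n : int) (B : trivial_braid) :
  external_twist (rotate n B) = external_twist B.
Proof. by rewrite /external_twist /=; ring. Qed.

Lemma internal_twist_rotate (n : int) (B : trivial_braid) :
  internal_twist (rotate n B) = internal_twist B.
Proof. exact: sum_permute. Qed.

Lemma external_twist_equiv (B B' : trivial_braid) :
  braid_equiv B B' -> external_twist B = external_twist B'.
Proof. by case=> [] [n ->]; rewrite external_twist_rotate. Qed.

Lemma internal_twist_equiv (B B' : trivial_braid) :
  braid_equiv B B' -> internal_twist B = internal_twist B'.
Proof. by case=> [] [n ->]; rewrite internal_twist_rotate. Qed.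

Lemma external_twist_csum (B B' C : trivial_braid) :
  csum B B' = Some C -> external_twist C = external_twist B + external_twist B'.
Proof.
rewrite /csum; case: ifP => // /andP[_ BB'0] [<-]; rewrite /external_twist /=.
(* The sum drops the two twists on the glued edge; being defined forces them to cancel, so nothing
   is lost. *)
have -> : rtwist B = - ltwist B' by apply/eqP; rewrite -addr_eq0 BB'0.
by ring.
Qed.

Lemma internal_twist_csum (B B' C : trivial_braid) :
  csum B B' = Some C -> internal_twist C = internal_twist B + internal_twist B'.
Proof.
rewrite /csum; case: ifP => // _ [<-].
by rewrite /internal_twist -big_split; apply: eq_bigr => i _; rewrite /= ffunE.
Qed.

Theorem corollary1 (B B' Bf : trivial_braid)
  (hint : interaction_condition B B')
  (hBf : represents_interaction B B' Bf) :
  [/\ ltwist B + rtwist B + ltwist B' + rtwist B' = ltwist Bf + rtwist Bf,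
      \sum_(i < 3) (itwists B i + itwists B' i) = \sum_(i < 3) itwists Bf i,
      state_sq Bf = state_sq B &
      state_sq B = state_sq B'].
Proof.
case: hBf => C hC hequiv.
split; try by rewrite !state_sqE.
- rewrite -[RHS]/(external_twist Bf) (external_twist_equiv hequiv).
  (* Either way the common edge carries 0 on one side and [common_twist B B'] on the other, the same
     total as before. *)
  by case: hC => /external_twist_csum ->;
    rewrite external_twist_rotate /external_twist /common_twist /=; ring.
- rewrite big_split -[RHS]/(internal_twist Bf) (internal_twist_equiv hequiv).
  by case: hC => /internal_twist_csum ->; rewrite internal_twist_rotate.
Qed.
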